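(* Let $A\in\mathbb{R}^{n,n}$, $B\in\mathbb{R}^{n,m}$ and $C\in\mathbb{R}^{p,n}$. For $(J,R,Q)\in(\mathbb{R}^{n,n})^3$ let $f(J,R,Q):=B^{\dagger}(A-(J-R)Q)C^{\dagger}$. Then $$\mathcal K(A,B,C)=\Big\{\, f(J,R,Q)+Z-B^{\dagger}BZCC^{\dagger} \;\Big|\; (J,R,Q)\in\mathbb{D}\mathbb{H}_{\succ}^n,\ B f(J,R,Q) C=A-(J-R)Q,\ Z\in\mathbb{R}^{m,p}\Big\}.$$
   Context: $\mathbb{R}^{n,m}$ denotes the set of real $n\times m$ matrices. $X^T$ is the transpose and $X^{\dagger}$ the Moore-Penrose pseudoinverse of $X$. $X\succ0$ (resp. $X\succeq 0$) means $X$ is symmetric positive definite (resp. symmetric positive semidefinite). A real square matrix is called stable if all its eigenvalues have real part $\le 0$ and every eigenvalue on the imaginary axis is semisimple. For $A\in\mathbb{R}^{n,n}$, $B\in\mathbb{R}^{n,m}$, $C\in\mathbb{R}^{p,n}$, $\mathcal K(A,B,C):=\{K\in\mathbb{R}^{m,p} \mid A-BKC \text{ is stable}\}$. The set $\mathbb{D}\mathbb{H}_{\succ}^n:=\{(J,R,Q)\in(\mathbb{R}^{n,n})^3 \mid J^T=-J,\ R\succeq 0,\ Q\succ 0\}$. *)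

(* Defs.v *)
From HB Require Import structures.
From mathcomp Require Import all_boot all_order all_algebra.
From mathcomp Require Import complex.
From mathcomp Require Import boolp classical_sets reals.

Set Implicit Arguments.
Unset Strict Implicit.
Unset Printing Implicit Defensive.

Import Order.TTheory GRing.Theory Num.Theory.

Local Open Scope ring_scope.
Local Open Scope complex_scope.
Local Open Scope classical_set_scope.

Definition penrose (R : realType) (m n : nat) (X : 'M[R]_(m, n))
    (Y : 'M[R]_(n, m)) : Prop :=
  [/\ X *m Y *m X = X, Y *m X *m Y = Y,
      (X *m Y)^T = X *m Y & (Y *m X)^T = Y *m X].

(* The default value 0 is never used: [pinv_penrose] and [penrose_uniq] show
   that [pinv X] is the one and only solution of the Penrose equations. *)
Definition pinv (R : realType) (m n : nat) (X : 'M[R]_(m, n)) : 'M[R]_(n, m) :=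
  xget 0 [set Y | penrose X Y].

Lemma gram_unit (R : realType) (m n : nat) (U : 'M[R]_(m, n)) :
  row_free U -> U *m U^T \in unitmx.
Proof.
move=> fU; rewrite -row_free_unit -kermx_eq0; apply/eqP/row_matrixP => i.
rewrite row0; set v := row i _.
have v0 : v *m (U *m U^T) = 0 by apply/sub_kermxP; exact: row_sub.
apply: (row_free_inj fU); rewrite mul0mx; set w := v *m U.
have w0 : w *m w^T = 0 by rewrite trmx_mul mulmxA -(mulmxA v) v0 mul0mx.
apply/rowP => j; rewrite [RHS]mxE; move: w0; clearbody w => w0.
move/matrixP/(_ 0 0): w0; rewrite !mxE => /eqP; rewrite psumr_eq0; last first.
  by move=> k _; rewrite mxE -expr2 sqr_ge0.
by move=> /allP /(_ j); rewrite mem_index_enum mxE mulf_eq0 orbb => /(_ isT)/eqP.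
Qed.

Lemma penrose_exists (R : realType) (m n : nat) (X : 'M[R]_(m, n)) :
  exists Y, penrose X Y.
Proof.
have fL : row_free (col_base X)^T.
  by rewrite /row_free mxrank_tr; exact: col_base_full.
have := row_base_free X; have := mulmx_base X.
move: (col_base X) (row_base X) fL; move: (\rank X) => r L U fL XE fU.
have uU : U *m U^T \in unitmx by exact: gram_unit.
have uL : L^T *m L \in unitmx.
  by rewrite -[X in _ *m X]trmxK; exact: gram_unit.
have sU : (invmx (U *m U^T))^T = invmx (U *m U^T).
  by rewrite trmx_inv trmx_mul trmxK.
have sL : (invmx (L^T *m L))^T = invmx (L^T *m L).
  by rewrite trmx_inv trmx_mul trmxK.
pose P := U^T *m invmx (U *m U^T); pose N := invmx (L^T *m L) *m L^T.
have UP : U *m P = 1%:M by rewrite mulmxA mulmxV.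
have NL : N *m L = 1%:M by rewrite -mulmxA mulVmx.
have sLN : (L *m N)^T = L *m N by rewrite !trmx_mul sL trmxK mulmxA.
have sPU : (P *m U)^T = P *m U by rewrite !trmx_mul sU trmxK -mulmxA.
clearbody P N; rewrite -XE; exists (P *m N).
have XY : L *m U *m (P *m N) = L *m N.
  by rewrite -mulmxA (mulmxA U) UP mul1mx.
have YX : P *m N *m (L *m U) = P *m U.
  by rewrite -mulmxA (mulmxA N) NL mul1mx.
split; rewrite ?XY ?YX //.
- by rewrite -mulmxA (mulmxA N) NL mul1mx.
- by rewrite -mulmxA (mulmxA U) UP mul1mx.
Qed.

Lemma pinv_penrose (R : realType) (m n : nat) (X : 'M[R]_(m, n)) :
  penrose X (pinv X).
Proof. by have [Y XY] := penrose_exists X; exact: xgetI XY. Qed.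

Lemma penrose_uniq (R : realType) (m n : nat) (X : 'M[R]_(m, n))
    (Y Z : 'M[R]_(n, m)) :
  penrose X Y -> penrose X Z -> Y = Z.
Proof.
move=> [xy1 xy2 xy3 xy4] [xz1 xz2 xz3 xz4].
have e1 : X *m Y = X *m Z.
  by rewrite -xy3 -{1}xz1 -mulmxA trmx_mul xy3 xz3 mulmxA xy1.
have e2 : Y *m X = Z *m X.
  by rewrite -xy4 -{1}xz1 -mulmxA mulmxA trmx_mul xy4 xz4 -mulmxA
             (mulmxA X) xy1.
by rewrite -xy2 -mulmxA e1 mulmxA e2 xz2.
Qed.

Definition posdefmx (R : realType) (n : nat) (X : 'M[R]_n) : Prop :=
  X^T = X /\ forall x : 'cV[R]_n, x != 0 -> 0 < (x^T *m X *m x) 0 0.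

Definition possemidefmx (R : realType) (n : nat) (X : 'M[R]_n) : Prop :=
  X^T = X /\ forall x : 'cV[R]_n, 0 <= (x^T *m X *m x) 0 0.

(* Geometric multiplicity = algebraic multiplicity.  MathComp's [eigenspace]
   consists of row (left) eigenvectors; its rank is also the dimension of the
   space of right eigenvectors. *)
Definition semisimple_eigenvalue (F : fieldType) (n : nat) (M : 'M[F]_n)
    (z : F) : Prop :=
  eigenvalue M z /\ \rank (eigenspace M z) = mup z (char_poly M).

Definition stablemat (R : realType) (n : nat) (M : 'M[R]_n) : Prop :=
  let MC : 'M[R[i]]_n := map_mx (real_complex R) M in
  forall z : R[i], eigenvalue MC z ->
    complex.Re z <= 0 /\ (complex.Re z = 0 -> semisimple_eigenvalue MC z).

Definition stabilizing_feedbacks (R : realType) (n m p : nat) (A : 'M[R]_n)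
    (B : 'M[R]_(n, m)) (C : 'M[R]_(p, n)) : set 'M[R]_(m, p) :=
  [set K | stablemat (A - B *m K *m C)].

Definition DHpos (R : realType) (n : nat) :
    set ('M[R]_n * 'M[R]_n * 'M[R]_n) :=
  [set D | let: (J, Rm, Q) := D in
     [/\ J^T = - J, possemidefmx Rm & posdefmx Q]].

(* Main.v *)
(* A real matrix M is stable iff M = (J - R) Q with J skew, R >= 0 and Q > 0,
   i.e. iff M is dissipative for the inner product of some P = Q^-1 > 0; the
   feedbacks are then obtained by solving B K C = A - M with the Penrose
   equations.

   If M is dissipative for P, an eigenvector shows Re z <= 0, and for Re z = 0 a
   chain u (M - z) = v, v (M - z) = 0 makes Re <v, s v + u> <= 0 for every real
   s, so v = 0 and z is semisimple.  Conversely, over the complex numbers the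
   imaginary eigenspaces, being semisimple, split off as blocks z I; the
   remaining part has its spectrum in the open left half-plane and is brought,
   one eigenspace at a time, to a block triangular form whose off-diagonal block
   is scaled down until the matrix is dissipative.  If S M S^-1 is dissipative,
   then P = Re (S^-1 S^-1^* ) is the real inner product sought.

   Vectors are rows, as in MathComp's eigenspaces. *)

Require Import Defs.
From HB Require Import structures.
From mathcomp Require Import all_boot all_order all_algebra.
From mathcomp Require Import complex zify lra ring.
From mathcomp Require Import boolp classical_sets reals.

Set Implicit Arguments.
Unset Strict Implicit.
Unset Printing Implicit Defensive.

Import Order.TTheory GRing.Theory Num.Theory.

Local Open Scope ring_scope.
Local Open Scope classical_set_scope.

(** * Similarity of matrices and eigenspace block forms over a field *)

Section Similarity.
Variable F : fieldType.
Implicit Types n k q r : nat.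

(** The two sizes are independent because block forms have a size such as [r + q], which is not
    convertible to [n]. A rectangular two-sided inverse avoids casts and forces the sizes to
    agree. *)
Definition simmx n k (M : 'M[F]_n) (N : 'M[F]_k) : Prop :=
  exists (S : 'M[F]_(k, n)) (S' : 'M[F]_(n, k)),
    [/\ S *m S' = 1%:M, S' *m S = 1%:M & S *m M = N *m S].

Lemma simmx_dim n k (M : 'M[F]_n) (N : 'M[F]_k) : simmx M N -> n = k.
Proof.
move=> [S [S' [SS' S'S _]]]; apply/eqP.
by rewrite eqn_leq (mulmx1_min SS') (mulmx1_min S'S).
Qed.

Lemma simmx_trans n k l (M : 'M[F]_n) (N : 'M[F]_k) (L : 'M[F]_l) :
  simmx M N -> simmx N L -> simmx M L.
Proof.
move=> [S [S' [SS' S'S SM]]] [T [T' [TT' T'T TN]]].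
exists (T *m S), (S' *m T'); split.
- by rewrite mulmxA -(mulmxA T) SS' mulmx1.
- by rewrite mulmxA -(mulmxA S') T'T mulmx1.
- by rewrite -mulmxA SM mulmxA TN mulmxA.
Qed.

Lemma simmx_char_poly n k (M : 'M[F]_n) (N : 'M[F]_k) :
  simmx M N -> char_poly M = char_poly N.
Proof.
move=> MN; have e := simmx_dim MN; case: _ / e N MN => N [S [S' [SS' _ SM]]].
rewrite /char_poly; set pS := map_mx polyC S; set pS' := map_mx polyC S'.
have SS'1 : pS *m pS' = 1%:M by rewrite -map_mxM SS' map_mx1.
have -> : char_poly_mx N = pS *m char_poly_mx M *m pS'.
  rewrite /char_poly_mx mulmxBr mulmxBl -[pS *m map_mx _ _]map_mxM SM map_mxM.
  by rewrite scalar_mxC -!mulmxA -/pS SS'1 !mulmx1.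
by rewrite !det_mulmx mulrAC -det_mulmx SS'1 det1 mul1r.
Qed.

Lemma simmx_rank_eigenspace n k (M : 'M[F]_n) (N : 'M[F]_k) z :
  simmx M N -> \rank (eigenspace M z) = \rank (eigenspace N z).
Proof.
move=> MN; have e := simmx_dim MN; case: _ / e N MN => N [S [S' [SS' S'S SM]]].
rewrite !mxrank_ker; congr (_ - _)%N.
have -> : N - z%:M = S *m (M - z%:M) *m S'.
  by rewrite mulmxBr SM scalar_mxC mulmxBl -!mulmxA SS' !mulmx1.
rewrite mxrankMfree ?row_free_unit; last by case: (mulmx1_unit S'S).
by rewrite eqmxMfull // row_full_unit; case: (mulmx1_unit SS').
Qed.

Lemma char_poly_lblock n k (A : 'M[F]_n) (X : 'M[F]_(k, n)) (D : 'M[F]_k) :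
  char_poly (block_mx A 0 X D) = char_poly A * char_poly D.
Proof.
rewrite /char_poly /char_poly_mx map_block_mx map_mx0 scalar_mx_block.
by rewrite opp_block_mx add_block_mx oppr0 addr0 det_lblock.
Qed.

Lemma char_poly_scalar r z : char_poly (z%:M : 'M[F]_r) = ('X - z%:P) ^+ r.
Proof.
by rewrite /char_poly /char_poly_mx map_scalar_mx -raddfB det_scalar.
Qed.

Lemma rank_eigenspace_diag_block r q z w (D : 'M[F]_q) :
  \rank (eigenspace (block_mx z%:M 0 0 D : 'M_(r + q)) w) =
  ((z == w) * r + \rank (eigenspace D w))%N.
Proof.
rewrite !mxrank_ker scalar_mx_block opp_block_mx add_block_mx !oppr0 !addr0.
rewrite rank_diag_block_mx -raddfB.
have [->|zw] := eqVneq z w.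
  by rewrite subrr raddf0 mxrank0 add0n mul1n addnBA ?rank_leq_row.
have -> : \rank ((z - w)%:M : 'M[F]_r) = r.
  by apply: mxrank_unit; rewrite unitmxE det_scalar unitrX ?unitfE ?subr_eq0.
by rewrite subnDl.
Qed.

(** A basis of the row eigenspace is completed to a basis of the whole space. Invariance of the
    eigenspace gives the zero block, and [D] is the action on the quotient. *)
Lemma eigen_block n (M : 'M[F]_n) z :
  exists q (X : 'M[F]_(q, \rank (eigenspace M z))) (D : 'M[F]_q),
    simmx M (block_mx z%:M 0 X D).
Proof.
set E := eigenspace M z; exists (\rank (E^C)%MS).
pose S := col_mx (row_base E) (row_base (E^C)%MS).
have fullS : row_full S.
  rewrite -sub1mx (submx_trans (_ : 1%:M <= E + E^C)%MS) //.
    by rewrite sub1mx addsmx_compl_full.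
  by rewrite -addsmxE addsmxS ?eq_row_base.
have freeS : row_free S.
  by rewrite -row_leq_rank (eqnP fullS) mxrank_compl subnKC ?rank_leq_col.
exists (lsubmx (row_base (E^C)%MS *m M *m pinvmx S)).
exists (rsubmx (row_base (E^C)%MS *m M *m pinvmx S)).
exists S, (pinvmx S); split; [exact: mulmxVp|exact: mulVpmx|].
rewrite -[block_mx _ _ _ _]/(col_mx (row_mx _ _) (row_mx _ _)) hsubmxK.
rewrite !mul_col_mx; congr col_mx.
  rewrite mul_row_col mul0mx addr0 mul_scalar_mx.
  by apply/eigenspaceP; rewrite eq_row_base.
by rewrite -mulmxA mulVpmx // mulmx1.
Qed.

Lemma mup_char_poly_block_scalar r q z w (X : 'M[F]_(q, r)) (D : 'M[F]_q) :
  mup w (char_poly (block_mx z%:M 0 X D)) =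
  ((z == w) * r + mup w (char_poly D))%N.
Proof.
rewrite char_poly_lblock char_poly_scalar mupM ?expf_neq0 ?polyXsubC_eq0 //.
  by rewrite mup_XsubCX; case: (z == w); rewrite ?mul1n.
exact/monic_neq0/char_poly_monic.
Qed.

Lemma mup_char_poly_eq0 n (M : 'M[F]_n) z :
  (mup z (char_poly M) == 0)%N = ~~ eigenvalue M z.
Proof.
rewrite eigenvalue_root_char root_factor_theorem XsubC_dvd ?lt0n ?negbK //.
exact/monic_neq0/char_poly_monic.
Qed.

Lemma rank_eigenspace_eq0 n (M : 'M[F]_n) z :
  (\rank (eigenspace M z) == 0)%N = ~~ eigenvalue M z.
Proof. by rewrite mxrank_eq0 /eigenvalue negbK. Qed.

(** Conjugation by the unipotent matrix with lower left block [Y] removes [X] as soon as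
    [(D - z%:M) *m Y = X], which is solvable because [D - z%:M] is invertible. *)
Lemma simmx_block_decouple r q z (X : 'M[F]_(q, r)) (D : 'M[F]_q) :
  ~~ eigenvalue D z ->
  simmx (block_mx z%:M 0 X D) (block_mx (z%:M : 'M_r) 0 0 D).
Proof.
rewrite -rank_eigenspace_eq0 mxrank_eq0 kermx_eq0 row_free_unit => uD.
pose Y := invmx (D - z%:M) *m X.
have YE : Y *m z%:M + X = D *m Y.
  have : (D - z%:M) *m Y = X by exact: mulKVmx.
  by rewrite mulmxBl scalar_mxC => <-; rewrite addrC subrK.
pose S c : 'M[F]_(r + q) := block_mx 1%:M 0 c 1%:M; exists (S Y), (S (- Y)).
rewrite !mulmx_block
  !(mul1mx, mulmx1, mul0mx, mulmx0, addr0, add0r).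
by rewrite subrr addNr -!scalar_mx_block YE; split.
Qed.

(** The scalar block already exhausts the algebraic multiplicity of [z], so [z] is not an eigenvalue
    of the other block and the two decouple. *)
Lemma semisimple_split n (M : 'M[F]_n) z :
  \rank (eigenspace M z) = mup z (char_poly M) ->
  exists q (D : 'M[F]_q),
    ~~ eigenvalue D z /\
    simmx M (block_mx (z%:M : 'M_(\rank (eigenspace M z))) 0 0 D).
Proof.
move=> rkE; have [q [X [D MN]]] := eigen_block M z.
have Dz : ~~ eigenvalue D z.
  move: rkE; rewrite (simmx_char_poly MN) mup_char_poly_block_scalar eqxx mul1n.
  rewrite -mup_char_poly_eq0 => /eqP.
  by rewrite -{1}[\rank _]addn0 eqn_add2l eq_sym.
exists q, D; split=> //; apply: simmx_trans MN _; exact: simmx_block_decouple.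
Qed.

(** The hypothesis excludes Jordan chains of length two. Were [z] an eigenvalue of [D] with
    eigenvector [y], the row (0, y) would be killed by the square of [N - z%:M], hence by [N - z%:M]
    itself: an eigenvector outside the scalar block, whose size is the full dimension of the
    eigenspace. *)
Lemma semisimple_of_ker n (M : 'M[F]_n) z :
  (forall u : 'rV_n, u *m (M - z%:M) *m (M - z%:M) = 0 ->
     u *m (M - z%:M) = 0) ->
  \rank (eigenspace M z) = mup z (char_poly M).
Proof.
move=> kerM; have [q [X [D MN]]] := eigen_block M z.
rewrite {1}(simmx_char_poly MN) mup_char_poly_block_scalar eqxx mul1n.
suff /eqP-> : (mup z (char_poly D) == 0)%N by rewrite addn0.
rewrite mup_char_poly_eq0; apply/negP => /eigenvalueP[y yD yN0].
have := simmx_rank_eigenspace z MN; case: MN => S [S' [SS' S'S SM]].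
set N := block_mx _ _ _ _ in SM *.
have SMz : S *m (M - z%:M) = (N - z%:M) *m S.
  by rewrite mulmxBl mulmxBr SM scalar_mxC.
have NzE : N - z%:M = col_mx 0 (row_mx X (D - z%:M)).
  rewrite scalar_mx_block opp_block_mx add_block_mx subrr !oppr0 !addr0.
  by rewrite /block_mx row_mx0.
pose u := row_mx (0 : 'rV[F]_(\rank (eigenspace M z))) y.
have uN : u *m (N - z%:M) = row_mx (y *m X) 0.
  rewrite NzE mul_row_col mul0mx add0r mul_mx_row mulmxBr yD -mul_mx_scalar.
  by rewrite subrr.
have uNN : u *m (N - z%:M) *m (N - z%:M) = 0.
  by rewrite uN NzE mul_row_col mulmx0 mul0mx addr0.
have : u *m S *m (M - z%:M) = 0.
  by apply: kerM; rewrite -(mulmxA u) SMz mulmxA -(mulmxA _ S) SMz mulmxA uNN mul0mx.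
rewrite -mulmxA SMz mulmxA => /(congr1 (mulmx^~ S')).
rewrite -mulmxA SS' mulmx1 mul0mx NzE mul_row_col mul0mx add0r => y0.
(* The eigenspace of [N] has the size of the scalar block, so [N - z%:M] has rank [q] and its [q]
   lower rows are free. *)
rewrite [RHS]mxrank_ker NzE rank_col_0mx => rkN.
have freeXD : row_free (row_mx X (D - z%:M)).
  rewrite /row_free; have := rank_leq_row (row_mx X (D - z%:M)).
  have := rank_leq_col (eigenspace M z).
  move: rkN; lia.
by move/eqP: yN0; apply; apply: (row_free_inj freeXD); rewrite y0 mul0mx.
Qed.

(** Conjugation by diag(1, e). Over the complex numbers, a small [e] makes the coupling block as
    small as needed. *)
Lemma simmx_block_scale r q (e : F) (A : 'M[F]_r) (X : 'M[F]_(q, r))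
    (D : 'M[F]_q) :
  e != 0 -> simmx (block_mx A 0 X D) (block_mx A 0 (e *: X) D).
Proof.
move=> e0; pose S c : 'M[F]_(r + q) := block_mx 1%:M 0 0 c%:M.
exists (S e), (S e^-1); rewrite !mulmx_block
  !(mul1mx, mulmx1, mul0mx, mulmx0, addr0, add0r).
by rewrite -!scalar_mxM mulfV ?mulVf // -!scalar_mx_block scalar_mxC mul_scalar_mx.
Qed.

(** Conjugation by diag(1, S) carries a change of basis for [D], supplied by an induction
    hypothesis, over to the whole block matrix. *)
Lemma simmx_block_dr r q k (A : 'M[F]_r) (X : 'M[F]_(q, r)) (D : 'M[F]_q)
    (N : 'M[F]_k) :
  simmx D N ->
  exists T : 'M_(k, q), simmx (block_mx A 0 X D) (block_mx A 0 (T *m X) N).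
Proof.
move=> [S [S' [SS' S'S SD]]]; exists S.
pose U a b (V : 'M_(a, b)) : 'M[F]_(r + a, r + b) := block_mx 1%:M 0 0 V.
exists (U _ _ S), (U _ _ S'); rewrite !mulmx_block
  !(mul1mx, mulmx1, mul0mx, mulmx0, addr0, add0r).
by rewrite SS' S'S SD -!scalar_mx_block.
Qed.

End Similarity.

(** * Real and imaginary parts of complex matrices *)

Section Hermitian.
Variable R : realType.
Local Notation C := R[i]%C.
Implicit Types n k m : nat.

Definition Remx m n (X : 'M[C]_(m, n)) : 'M[R]_(m, n) := map_mx (@complex.Re R) X.
Definition Immx m n (X : 'M[C]_(m, n)) : 'M[R]_(m, n) := map_mx (@complex.Im R) X.
Definition complexmx m n (X : 'M[R]_(m, n)) : 'M[C]_(m, n) :=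
  map_mx (real_complex R) X.

Lemma ReD (x y : C) : complex.Re (x + y) = complex.Re x + complex.Re y.
Proof. by case: x; case: y. Qed.

Lemma ImD (x y : C) : complex.Im (x + y) = complex.Im x + complex.Im y.
Proof. by case: x; case: y. Qed.

Lemma ReM (x y : C) : complex.Re (x * y) =
  complex.Re x * complex.Re y - complex.Im x * complex.Im y.
Proof. by case: x; case: y. Qed.

Lemma ImM (x y : C) : complex.Im (x * y) =
  complex.Re x * complex.Im y + complex.Im x * complex.Re y.
Proof. by case: x; case: y. Qed.

Lemma RemxD m n (X Y : 'M[C]_(m, n)) : Remx (X + Y) = Remx X + Remx Y.
Proof. by apply/matrixP => i j; rewrite !mxE ReD. Qed.

Lemma ImmxD m n (X Y : 'M[C]_(m, n)) : Immx (X + Y) = Immx X + Immx Y.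
Proof. by apply/matrixP => i j; rewrite !mxE ImD. Qed.

Lemma RemxZ m n z (X : 'M[C]_(m, n)) :
  Remx (z *: X) = complex.Re z *: Remx X - complex.Im z *: Immx X.
Proof. by apply/matrixP => i j; rewrite !mxE ReM. Qed.

Lemma ImmxZ m n z (X : 'M[C]_(m, n)) :
  Immx (z *: X) = complex.Re z *: Immx X + complex.Im z *: Remx X.
Proof. by apply/matrixP => i j; rewrite !mxE ImM. Qed.

Lemma RemxM m n k (X : 'M[C]_(m, n)) (Y : 'M[C]_(n, k)) :
  Remx (X *m Y) = Remx X *m Remx Y - Immx X *m Immx Y.
Proof.
apply/matrixP => i j; rewrite !mxE (big_morph _ ReD (erefl _)) -sumrB.
by apply: eq_bigr => l _; rewrite ReM !mxE.
Qed.

Lemma ImmxM m n k (X : 'M[C]_(m, n)) (Y : 'M[C]_(n, k)) :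
  Immx (X *m Y) = Remx X *m Immx Y + Immx X *m Remx Y.
Proof.
apply/matrixP => i j; rewrite !mxE (big_morph _ ImD (erefl _)) -big_split /=.
by apply: eq_bigr => l _; rewrite ImM !mxE.
Qed.

Lemma Remx_complexmx m n (X : 'M[R]_(m, n)) : Remx (complexmx X) = X.
Proof. by apply/matrixP => i j; rewrite !mxE. Qed.

Lemma Immx_complexmx m n (X : 'M[R]_(m, n)) : Immx (complexmx X) = 0.
Proof. by apply/matrixP => i j; rewrite !mxE. Qed.

Lemma Remx_Immx_eq0 m n (X : 'M[C]_(m, n)) : Remx X = 0 -> Immx X = 0 -> X = 0.
Proof.
move=> /matrixP re0 /matrixP im0; apply/matrixP => i j; apply/eqP.
by rewrite eq_complex; move: (re0 i j) (im0 i j); rewrite !mxE => -> ->; rewrite eqxx.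
Qed.

(** * Real parts of sesquilinear forms and their bounds *)

Lemma tr11 (X : 'M[R]_1) : X^T 0 0 = X 0 0.
Proof. by rewrite mxE. Qed.

(* The real part of the sesquilinear form u P w^*. *)
Definition pdot n (P : 'M[R]_n) (u w : 'rV[C]_n) : R :=
  (Remx u *m P *m (Remx w)^T + Immx u *m P *m (Immx w)^T) 0 0.

Lemma pdotDl n P (u v w : 'rV[C]_n) : pdot P (u + v) w = pdot P u w + pdot P v w.
Proof. by rewrite /pdot RemxD ImmxD !mulmxDl !mxE addrACA. Qed.

Lemma pdotDr n P (u v w : 'rV[C]_n) : pdot P w (u + v) = pdot P w u + pdot P w v.
Proof. by rewrite /pdot RemxD ImmxD !linearD /= !mxE addrACA. Qed.

Lemma pdotZl n P (t : R) (u w : 'rV[C]_n) :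
  pdot P (real_complex R t *: u) w = t * pdot P u w.
Proof.
rewrite /pdot RemxZ ImmxZ /= !scale0r subr0 addr0 -!scalemxAl -scalerDr.
by rewrite mxE.
Qed.

Lemma pdotZr n P (t : R) (u w : 'rV[C]_n) :
  pdot P w (real_complex R t *: u) = t * pdot P w u.
Proof.
rewrite /pdot RemxZ ImmxZ /= !scale0r subr0 addr0 !linearZ /=.
by rewrite -scalerDr mxE.
Qed.

Lemma pdotC n (P : 'M[R]_n) (u w : 'rV[C]_n) :
  P^T = P -> pdot P u w = pdot P w u.
Proof.
move=> symP; rewrite /pdot -[RHS]tr11 linearD /= !trmx_mul !trmxK symP.
by rewrite !mulmxA.
Qed.

(** The imaginary part of [z] multiplies the difference of the two mixed terms in [Remx v] and
    [Immx v], which cancel by symmetry of [P]. *)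
Lemma pdot_scale n (P : 'M[R]_n) z (v : 'rV[C]_n) : P^T = P ->
  pdot P (z *: v) v = complex.Re z * pdot P v v.
Proof.
move=> symP; have : (Immx v *m P *m (Remx v)^T) 0 0 =
    (Remx v *m P *m (Immx v)^T) 0 0.
  by rewrite -[RHS]tr11 !trmx_mul trmxK symP mulmxA.
rewrite /pdot RemxZ ImmxZ !mulmxDl !mulNmx -!scalemxAl.
rewrite !mxE; move: (\sum_ _ _) => a; move: (\sum_ _ _) => b.
by move: (\sum_ _ _) => c; move: (\sum_ _ _) => d E; rewrite E; ring.
Qed.

(** A real matrix acts separately on real and imaginary parts, so it can be absorbed into the form;
    the new form is in general not symmetric. *)
Lemma pdot_mulmx_complexmx n (M P : 'M[R]_n) (u w : 'rV[C]_n) :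
  pdot P (u *m complexmx M) w = pdot (M *m P) u w.
Proof.
by rewrite /pdot RemxM ImmxM Remx_complexmx Immx_complexmx !mulmx0 subr0 add0r !mulmxA.
Qed.

Lemma row_norm_sum n (a : 'rV[R]_n) : (a *m a^T) 0 0 = \sum_i a 0 i ^+ 2.
Proof. by rewrite mxE; apply: eq_bigr => i _; rewrite mxE expr2. Qed.

Lemma posdefmx1 n : posdefmx (1%:M : 'M[R]_n).
Proof.
split=> [|x x0]; first exact: trmx1.
rewrite mulmx1 -[X in _ *m X]trmxK row_norm_sum lt_neqAle eq_sym sumr_ge0 ?andbT.
  apply: contra x0 => /eqP/psumr_eq0P x0; apply/eqP/colP => i.
  rewrite [RHS]mxE; apply/eqP; rewrite -sqrf_eq0 -[x i 0](mxE trmx_key (fun i j => x j i) 0 i).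
  by rewrite x0 // => j _; exact: sqr_ge0.
by move=> i _; exact: sqr_ge0.
Qed.

Lemma pdot_gt0 n (P : 'M[R]_n) (v : 'rV[C]_n) :
  posdefmx P -> v != 0 -> 0 < pdot P v v.
Proof.
move=> [_ posP] v0; have nneg (x : 'rV[R]_n) : 0 <= (x *m P *m x^T) 0 0.
  have [->|x0] := eqVneq x 0; first by rewrite !mul0mx mxE.
  rewrite -[X in X *m P]trmxK; apply/ltW/posP.
  by rewrite -[0]trmx0 (inj_eq trmx_inj).
have pos (x : 'rV[R]_n) : x != 0 -> 0 < (x *m P *m x^T) 0 0.
  move=> x0; rewrite -[X in X *m P]trmxK; apply/posP.
  by rewrite -[0]trmx0 (inj_eq trmx_inj).
rewrite /pdot mxE; have [re0|re0] := eqVneq (Remx v) 0.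
  rewrite ltr_wpDl ?pos //; apply: contra v0 => /eqP im0.
  by apply/eqP/Remx_Immx_eq0.
by rewrite ltr_pwDl ?pos.
Qed.

Lemma pdot1_ge0 n (v : 'rV[C]_n) : 0 <= pdot 1%:M v v.
Proof.
have [->|v0] := eqVneq v 0; last exact/ltW/pdot_gt0/v0/posdefmx1.
by have := pdotZl 1%:M 0 (0 : 'rV[C]_n) 0; rewrite mul0r scaler0 => ->.
Qed.

Lemma pdot_row_mx m n (u1 w1 : 'rV[C]_m) (u2 w2 : 'rV[C]_n) :
  pdot 1%:M (row_mx u1 u2) (row_mx w1 w2) = pdot 1%:M u1 w1 + pdot 1%:M u2 w2.
Proof.
rewrite /pdot /Remx /Immx !map_row_mx !mulmx1 !tr_row_mx !mul_row_col.
by rewrite !mxE; ring.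
Qed.

(** A crude bound suffices: every product of two entries of [a] is at most the squared norm in
    absolute value, so the sum of the absolute entries of [G] serves as [K]. *)
Lemma row_form_bounded n (G : 'M[R]_n) :
  exists2 K, 0 <= K &
    forall a : 'rV_n, (a *m G *m a^T) 0 0 <= K * (a *m a^T) 0 0.
Proof.
exists (\sum_j \sum_i `|G i j|).
  by apply: sumr_ge0 => j _; apply: sumr_ge0.
move=> a; rewrite row_norm_sum mxE mulr_suml ler_sum // => j _.
rewrite !mxE !mulr_suml ler_sum // => i _.
have le_sum l : a 0 l ^+ 2 <= \sum_k a 0 k ^+ 2.
  by rewrite (bigD1 l) //= lerDl sumr_ge0 // => k _; exact: sqr_ge0.
have aa : `|a 0 i * a 0 j| <= \sum_k a 0 k ^+ 2.
  move: (le_sum i) (le_sum j); move: (\sum_k _) (a 0 i) (a 0 j) => s x y xs ys.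
  by rewrite ler_norml; apply/andP; split; nra.
by rewrite mulrAC mulrC (le_trans (ler_norm _)) // normrM ler_wpM2l.
Qed.

Lemma pdot_mulmx_bounded m n (X : 'M[C]_(m, n)) :
  exists2 K, 0 <= K & forall y : 'rV_m,
    pdot 1%:M (y *m X) (y *m X) <= K * pdot 1%:M y y.
Proof.
(* The real matrix of right multiplication by [X] on pairs (Re y, Im y). *)
pose Y := block_mx (Remx X) (Immx X) (- Immx X) (Remx X).
have [K K0 leK] := row_form_bounded (Y *m Y^T).
have pdotE k (u : 'rV[C]_k) : pdot 1%:M u u =
    (row_mx (Remx u) (Immx u) *m (row_mx (Remx u) (Immx u))^T) 0 0.
  by rewrite tr_row_mx mul_row_col /pdot !mulmx1.
exists K => // y; rewrite !pdotE RemxM ImmxM.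
have -> : row_mx (Remx y *m Remx X - Immx y *m Immx X)
   (Remx y *m Immx X + Immx y *m Remx X) = row_mx (Remx y) (Immx y) *m Y.
  by rewrite mul_row_block mulmxN.
by rewrite trmx_mul mulmxA -(mulmxA _ Y); exact: leK.
Qed.

(** * Dissipative forms of stable complex matrices *)

(** [stablemat M] unfolds to this condition on [complexmx M]. General complex matrices are allowed
    because the blocks met in the induction need not be real. *)
Definition cstable n (M : 'M[C]_n) : Prop :=
  forall z : C, eigenvalue M z ->
    complex.Re z <= 0 /\ (complex.Re z = 0 -> semisimple_eigenvalue M z).

Definition dissipative n (M : 'M[C]_n) : Prop :=
  forall v : 'rV_n, pdot 1%:M (v *m M) v <= 0.

(** The uniform margin [c] is what absorbs the cross term when a further block is attached. *)
Definition strictly_dissipative n (M : 'M[C]_n) : Prop :=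
  exists2 c, 0 < c & forall v : 'rV_n,
    pdot 1%:M (v *m M) v <= - c * pdot 1%:M v v.

Lemma eigenvalue_simmx n k (M : 'M[C]_n) (N : 'M[C]_k) z :
  simmx M N -> eigenvalue M z = eigenvalue N z.
Proof.
by move=> MN; rewrite !eigenvalue_root_char (simmx_char_poly MN).
Qed.

Lemma pdot_block_mx r q (z : C) (X : 'M[C]_(q, r)) (D : 'M[C]_q) v1 v2 :
  pdot 1%:M (row_mx v1 v2 *m block_mx z%:M 0 X D) (row_mx v1 v2) =
  complex.Re z * pdot 1%:M v1 v1 + pdot 1%:M (v2 *m X) v1 +
  pdot 1%:M (v2 *m D) v2.
Proof.
rewrite mul_row_block mulmx0 add0r pdot_row_mx pdotDl mul_mx_scalar.
by rewrite pdot_scale ?trmx1.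
Qed.

Lemma simmx_strictly_dissipative n (M : 'M[C]_n) :
  (forall z, eigenvalue M z -> complex.Re z < 0) ->
  exists k (N : 'M[C]_k), simmx M N /\ strictly_dissipative N.
Proof.
elim/ltn_ind: n M => n IHn M negM.
have [n0|n_gt0] := posnP n.
  subst n; exists 0%N, M; split.
    by exists 1%:M, 1%:M; split; rewrite ?mulmx1 ?mul1mx.
  by exists 1 => // v; rewrite /pdot !mxE !big_ord0 addr0 mulr0.
have [z Mz] := eigenvalue_closed M n_gt0.
have [q [X [D MD]]] := eigen_block M z.
have r_gt0 : (0 < \rank (eigenspace M z))%N by rewrite lt0n rank_eigenspace_eq0 Mz.
have q_lt : (q < n)%N by rewrite (simmx_dim MD) -[X in (X < _)%N]add0n ltn_add2r.
have negD w : eigenvalue D w -> complex.Re w < 0.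
  move=> Dw; apply: negM; rewrite (eigenvalue_simmx _ MD).
  by rewrite eigenvalue_root_char char_poly_lblock rootM -!eigenvalue_root_char Dw orbT.
have [k [N [DN [c c0 dN]]]] := IHn q q_lt D negD.
have [T MN] := simmx_block_dr (z%:M) X DN.
have [K K0 leK] := pdot_mulmx_bounded (T *m X).
have d0 : 0 < - complex.Re z by rewrite oppr_gt0; exact: negM.
set d := - complex.Re z in d0.
(* Chosen so that [e <= 1] and [e * K <= c * d], whence the squared norm of [e w] is at most [c * d]
   times that of [y]. *)
pose e := c * d / (K + 1 + c * d).
have cd0 : 0 < c * d by exact: mulr_gt0.
have den0 : 0 < K + 1 + c * d by lra.
have e0 : 0 < e by exact: divr_gt0.
have e1 : e <= 1 by rewrite ler_pdivrMr //; lra.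
have eK : e * K <= c * d.
  by rewrite /e mulrAC ler_pdivrMr //; nra.
exists (\rank (eigenspace M z) + k)%N.
exists (block_mx z%:M 0 (real_complex R e *: (T *m X)) N); split.
  apply: simmx_trans MD _; apply: simmx_trans MN _; apply: simmx_block_scale.
  by rewrite fmorph_eq0 gt_eqF.
(* Half of the diagonal margins [d] and [c] pays for the cross term; the other half remains. *)
exists (Num.min d c / 2) => [|v].
  by rewrite divr_gt0 // lt_min d0.
rewrite -[v]hsubmxK pdot_block_mx pdot_row_mx; set x := lsubmx v; set y := rsubmx v.
rewrite -scalemxAr pdotZl.
have := leK y; have := dN y; have := pdot1_ge0 x; have := pdot1_ge0 y.
set w := y *m (T *m X).
(* The cross term is controlled by |e w - d x|^2 >= 0. *)
have : 0 <= pdot 1%:M (real_complex R e *: w + real_complex R (- d) *: x)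
   (real_complex R e *: w + real_complex R (- d) *: x) by exact: pdot1_ge0.
rewrite !(pdotDl, pdotDr, pdotZl, pdotZr) (pdotC x w) ?trmx1 //.
have -> : complex.Re z = - d by rewrite opprK.
move: (pdot _ (y *m N) y) (pdot _ w w) (pdot _ w x) (pdot _ x x) (pdot _ y y).
move=> ny ww wx xx yy amgm yy0 xx0 nyc wwK.
have mind : Num.min d c <= d by rewrite ge_min lexx.
have minc : Num.min d c <= c by rewrite ge_min lexx orbT.
have eww : e * (e * ww) <= c * d * yy.
  have le1 : e * ww <= e * K * yy by rewrite -mulrA ler_pM2l.
  have le2 : e * K * yy <= c * d * yy by rewrite ler_wpM2r.
  apply: le_trans le2; apply: (@le_trans _ _ (e * (e * K * yy))).
    by rewrite ler_pM2l.
  apply: ler_piMl => //; apply: mulr_ge0 => //.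
  by apply: mulr_ge0 => //; exact: ltW.
(* After multiplication by [d], this is [amgm] combined with [eww]. *)
have xw : e * wx <= (c * yy + d * xx) / 2.
  by rewrite -(ler_pM2l d0); nra.
by nra.
Qed.

Lemma simmx_dissipative n (M : 'M[C]_n) :
  cstable M -> exists k (N : 'M[C]_k), simmx M N /\ dissipative N.
Proof.
elim/ltn_ind: n M => n IHn M stM.
have [[z Mz rez]|noim] := pselect (exists2 z, eigenvalue M z & complex.Re z = 0).
  have [_ /(_ rez)[_ ssz]] := stM z Mz.
  have [q [D [Dz MD]]] := semisimple_split ssz.
  have r_gt0 : (0 < \rank (eigenspace M z))%N by rewrite lt0n rank_eigenspace_eq0 Mz.
  have q_lt : (q < n)%N by rewrite (simmx_dim MD) -[X in (X < _)%N]add0n ltn_add2r.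
  (* Passing from [M] to [D] lowers the geometric and the algebraic multiplicity of each [w] by the
     same amount, so semisimplicity is inherited. *)
  have stD : cstable D.
    move=> w Dw; have Mw : eigenvalue M w.
      rewrite (eigenvalue_simmx _ MD) eigenvalue_root_char char_poly_lblock.
      by rewrite rootM -!eigenvalue_root_char Dw orbT.
    have [rew ss] := stM w Mw; split=> // /ss[_ ssw]; split=> //.
    move: ssw; rewrite (simmx_rank_eigenspace w MD) (simmx_char_poly MD).
    by rewrite rank_eigenspace_diag_block mup_char_poly_block_scalar => /addnI.
  have [k [N [DN dN]]] := IHn q q_lt D stD.
  have [T MN] := simmx_block_dr (z%:M : 'M_(\rank (eigenspace M z))) 0 DN.
  rewrite mulmx0 in MN.
  exists (\rank (eigenspace M z) + k)%N, (block_mx z%:M 0 0 N); split.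
    exact: simmx_trans MD MN.
  move=> v; rewrite -[v]hsubmxK pdot_block_mx rez mul0r add0r mulmx0.
  by rewrite -[0 : 'rV__](scale0r (0 : 'rV_ _)) (pdotZl _ 0) mul0r add0r.
have [z Mz|k [N [MN [c c0 dN]]]] := simmx_strictly_dissipative (M := M).
  have [rez _] := stM z Mz; rewrite lt_neqAle rez andbT; apply/eqP => rez0.
  by apply: noim; exists z.
exists k, N; split=> // v; apply: le_trans (dN v) _.
by rewrite mulNr oppr_le0 mulr_ge0 ?pdot1_ge0 ?ltW.
Qed.

(** * Stability and dissipative Hamiltonian factorizations of real matrices *)

Lemma posdefmx_row n (P : 'M[R]_n) (x : 'rV_n) :
  posdefmx P -> x != 0 -> 0 < (x *m P *m x^T) 0 0.
Proof.
move=> [_ posP] x0; rewrite -[X in X *m P]trmxK; apply: posP.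
by rewrite -[0]trmx0 (inj_eq trmx_inj).
Qed.

Lemma posdefmx_unit n (P : 'M[R]_n) : posdefmx P -> P \in unitmx.
Proof.
move=> posP; rewrite -row_free_unit; apply: inj_row_free => v vP0.
apply/eqP/negPn/negP => /(posdefmx_row posP).
by rewrite vP0 mul0mx mxE ltxx.
Qed.

Lemma posdefmx_inv n (P : 'M[R]_n) : posdefmx P -> posdefmx (invmx P).
Proof.
move=> posP; have uP := posdefmx_unit posP; have [symP posP'] := posP.
split=> [|x x0]; first by rewrite trmx_inv symP.
have -> : x^T *m invmx P *m x = (invmx P *m x)^T *m P *m (invmx P *m x).
  by rewrite trmx_mul trmx_inv symP mulmxKV // mulmxA.
apply: posP'; apply: contra x0 => /eqP iPx0.
by rewrite -(mulKVmx uP x) iPx0 mulmx0.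
Qed.

Lemma stablemat_DHpos n (M : 'M[R]_n) : stablemat M ->
  exists J Rm Q : 'M[R]_n, DHpos (J, Rm, Q) /\ M = (J - Rm) *m Q.
Proof.
move=> stM; have [k [N [[S [S' [SS' S'S SM]]] dN]]] :
    exists k (N : 'M[C]_k), simmx (complexmx M) N /\ dissipative N.
  by apply: simmx_dissipative.
pose P := Remx S' *m (Remx S')^T + Immx S' *m (Immx S')^T.
have PE (a b : 'rV[R]_n) :
    pdot 1%:M (complexmx a *m S') (complexmx b *m S') = (a *m P *m b^T) 0 0.
  rewrite /pdot !RemxM !ImmxM !Remx_complexmx !Immx_complexmx !mul0mx !subr0 !addr0.
  by rewrite !mulmx1 !trmx_mul /P mulmxDr mulmxDl !mulmxA.
have symP : P^T = P by rewrite linearD /= !trmx_mul !trmxK.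
have posP : posdefmx P.
  split=> // x x0; rewrite -[X in _ *m X]trmxK -PE pdot_gt0 //.
    exact: posdefmx1.
  apply: contra x0 => /eqP /(congr1 (mulmx^~ S)).
  rewrite -mulmxA S'S mulmx1 mul0mx => /(congr1 (@Remx _ _)).
  rewrite Remx_complexmx => /(congr1 trmx); rewrite trmxK => ->.
  by apply/eqP/matrixP => i j; rewrite !mxE.
have MP_le0 (x : 'rV[R]_n) : (x *m (M *m P) *m x^T) 0 0 <= 0.
  rewrite mulmxA -PE [complexmx (x *m M)]map_mxM -mulmxA.
  suff -> : complexmx M *m S' = S' *m N by rewrite mulmxA; exact: dN.
  by rewrite -[LHS]mul1mx -S'S -mulmxA (mulmxA S) SM -!mulmxA SS' mulmx1.
(* [J] is the skew part of [M *m P] and [Rm] minus its symmetric part, which is nonnegative by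
   [MP_le0]. *)
pose J := 2^-1 *: (M *m P - (M *m P)^T).
pose Rm := - (2^-1 *: (M *m P + (M *m P)^T)).
exists J, Rm, (invmx P); split; last first.
  have -> : J - Rm = M *m P.
    by apply/matrixP => i j; rewrite !mxE; field.
  by rewrite mulmxK // posdefmx_unit.
split; last exact: posdefmx_inv.
  by rewrite linearZ linearB /= trmxK -scalerN opprB.
split; first by rewrite linearN linearZ linearD /= trmxK addrC.
move=> x; have := MP_le0 x^T; rewrite trmxK => le0.
have trE : (x^T *m (M *m P)^T *m x) 0 0 = (x^T *m (M *m P) *m x) 0 0.
  by move: (M *m P) => G; rewrite -[RHS]tr11 !trmx_mul trmxK mulmxA.
rewrite /Rm mulmxN mulNmx -scalemxAr -scalemxAl mulmxDr mulmxDl.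
rewrite [(- _ : matrix _ _ _) 0 0]mxE [(_ *: _ : matrix _ _ _) 0 0]mxE.
rewrite [(_ + _ : matrix _ _ _) 0 0]mxE trE.
by move: le0 => /=; lra.
Qed.

(** With [P = invmx Q] one has [M *m P = J - Rm]: the skew part contributes nothing to the real
    form, and [Rm] makes it nonpositive. *)
Lemma DHpos_stablemat n (J Rm Q : 'M[R]_n) :
  DHpos (J, Rm, Q) -> stablemat ((J - Rm) *m Q).
Proof.
move=> [skewJ [_ posRm] posQ]; have uQ := posdefmx_unit posQ.
set M := (J - Rm) *m Q; pose P := invmx Q.
have posP : posdefmx P := posdefmx_inv posQ.
have [symP _] := posP.
have J0 (x : 'rV[R]_n) : (x *m J *m x^T) 0 0 = 0.
  have : (x *m J *m x^T) 0 0 = - (x *m J *m x^T) 0 0; last by lra.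
  by rewrite -[LHS]tr11 !trmx_mul trmxK skewJ mulNmx mulmxN mulmxA [LHS]mxE.
have diss v : pdot P (v *m complexmx M) v <= 0.
  rewrite pdot_mulmx_complexmx /M mulmxK // /pdot !mulmxBr !mulmxBl mxE.
  rewrite [(_ - _ : matrix _ _ _) 0 0]mxE [X in _ + X]mxE !J0 !add0r.
  rewrite [(- _ : matrix _ _ _) 0 0]mxE.
  rewrite [X in _ + X]mxE -opprD oppr_le0 addr_ge0 //.
    by rewrite -[X in X *m Rm]trmxK posRm.
  by rewrite -[X in X *m Rm]trmxK posRm.
move=> z Mz; have rez : complex.Re z <= 0.
  have [v vM v0] := eigenvalueP Mz.
  have := diss v; rewrite [v *m _]vM pdot_scale // pmulr_lle0 //.
  exact: pdot_gt0.
split=> // rez0; split=> //; apply: semisimple_of_ker => u.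
set N := _ - _; set v := u *m N => vN; apply/eqP/negPn/negP => v0.
have vv := pdot_gt0 posP v0.
(* Subtracting a purely imaginary scalar does not change the real part of the form. *)
have dissN w : pdot P (w *m N) w <= 0.
  rewrite mulmxBr mul_mx_scalar -scaleNr pdotDl pdot_scale //.
  by rewrite raddfN /= rez0 oppr0 mul0r addr0; exact: diss.
(* (s v + u) N = v for every s, so Re <v, s v + u> <= 0 for every s. *)
pose s := (1 - pdot P v u) / pdot P v v.
have := dissN (real_complex R s *: v + u).
rewrite mulmxDl -scalemxAl vN scaler0 add0r -/v pdotDr pdotZr.
(* This [s] makes the form equal to 1, against its nonpositivity. *)
by rewrite divfK ?gt_eqF // subrK lt_geF.
Qed.

End Hermitian.

(** * Parametrization of the stabilizing feedbacks *)

Theorem theorem5 (R : realType) (n m p : nat) (A : 'M[R]_n)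
    (B : 'M[R]_(n, m)) (C : 'M[R]_(p, n)) :
  let f (J Rm Q : 'M[R]_n) : 'M[R]_(m, p) :=
    pinv B *m (A - (J - Rm) *m Q) *m pinv C in
  stabilizing_feedbacks A B C =
  [set K : 'M[R]_(m, p) |
    exists (J Rm Q : 'M[R]_n) (Z : 'M[R]_(m, p)),
      [/\ DHpos (J, Rm, Q),
          B *m f J Rm Q *m C = A - (J - Rm) *m Q
        & K = f J Rm Q + Z - pinv B *m B *m Z *m C *m pinv C]].
Proof.
move=> f; have [BpB _ _ _] := pinv_penrose B; have [CpC _ _ _] := pinv_penrose C.
apply/seteqP; split=> [K /stablemat_DHpos[J [Rm [Q [DH stK]]]]|].
  have ABKC : A - (J - Rm) *m Q = B *m K *m C by rewrite -stK opprB addrC subrK.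
  (* With [Z = K], the correction term equals [f J Rm Q] and cancels it, leaving [K]. *)
  exists J, Rm, Q, K; split; rewrite // /f ABKC !mulmxA; last by rewrite addrAC subrr add0r.
  by rewrite BpB -!mulmxA (mulmxA C) CpC.
move=> _ [J [Rm [Q [Z [DH Bf ->]]]]]; rewrite /stabilizing_feedbacks /=.
suff -> : A - B *m (f J Rm Q + Z - pinv B *m B *m Z *m C *m pinv C) *m C =
  (J - Rm) *m Q by exact: DHpos_stablemat.
(* Between [B] and [C] the correction term reduces to [B *m Z *m C], so the free parameter drops
   out. *)
rewrite mulmxBr mulmxBl mulmxDr mulmxDl Bf !mulmxA BpB -!mulmxA (mulmxA C) CpC.
by rewrite addrK opprB addrC subrK.
Qed.
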